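(* Let $n\ge1$, let $w_0,\dots,w_n$ be positive integers, $\mu=w_0+\cdots+w_n$, and let $F^{sing}(\boldsymbol t)=\sum_{\boldsymbol\alpha\in\mathbb{N}^\mu}A(\boldsymbol\alpha)\frac{t^{\boldsymbol\alpha}}{\boldsymbol\alpha!}$ be the potential, in the flat coordinates $t_0,\dots,t_{\mu-1}$, of the canonical Frobenius structure attached to the Laurent polynomial $f(u_0,\dots,u_n)=u_0+\cdots+u_n$ on $U=\{\prod_iu_i^{w_i}=1\}\subset\mathbb{C}^{n+1}$. Then $F^{sing}$ is determined by the numbers $A_{1jk}(\boldsymbol0)$ with $j,k\in\{0,\dots,\mu-1\}$ such that $\overline{1+j+k}=n$; that is, all its coefficients $A(\boldsymbol\alpha)$ with $\alpha_0+\cdots+\alpha_{\mu-1}\ge3$ are uniquely determined by these numbers through the WDVV equations, the homogeneity condition and the initial conditions recalled in the context.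
   Context: $\overline m$ is reduction modulo $\mu$ in $\{0,\dots,\mu-1\}$. $I(\gamma)=\{i\mid\gamma w_i\in\mathbb{Z}\}$; $s(0)\le\cdots\le s(\mu-1)$ is the nondecreasing enumeration with repetitions of the disjoint union over $i$ of $\{\ell/w_i\mid0\le\ell\le w_i-1\}$; $\sigma(i)=i-\mu s(i)$. $A_{ijk}(\boldsymbol\alpha)$ denotes $A(\boldsymbol\alpha+\epsilon_i+\epsilon_j+\epsilon_k)$, where $\epsilon_i$ are the standard basis vectors of $\mathbb{N}^\mu$; so $A_{ijk}(\boldsymbol 0)=F^{sing}_{ijk}(0)$, with $F^{sing}_{ijk}=\partial^3F^{sing}/\partial t_i\partial t_j\partial t_k$. The Frobenius structure lives on the germ of the base of a universal unfolding of $f$; $t_0,\dots,t_{\mu-1}$ are flat coordinates centered at the base point in which the (constant) flat form is $g(\partial_{t_k},\partial_{t_\ell})=\left(\prod_{i\in I(s(k))}w_i\right)^{-1}$ if $\overline{k+\ell}=n$ and $0$ otherwise, and the Euler field is $\mathfrak{E}=\sum_{k=0}^{\mu-1}(1-\sigma(k))t_k\partial_{t_k}+\mu\partial_{t_1}$. Write $(g^{ab})$ for the inverse matrix of $g$, and $a^\star$ for the unique index with $g^{aa^\star}\ne0$. The potential satisfies, for all $i,j,k,\ell$: (WDVV) $\sum_aF^{sing}_{ija}g^{aa^\star}F^{sing}_{a^\star k\ell}=\sum_aF^{sing}_{jka}g^{aa^\star}F^{sing}_{a^\star i\ell}$; (homogeneity) $\mathfrak{E}\cdot F^{sing}=(3-n)F^{sing}$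 (the potential being considered up to polynomials of degree $\le2$); (initial conditions) $F^{sing}_{ijk}(\boldsymbol0)=g|_{\boldsymbol t=0}(\partial_{t_i}\star\partial_{t_j},\partial_{t_k})$, $\star$ being the product of the Frobenius structure. At $\boldsymbol t=0$, $\partial_{t_i}\star\partial_{t_j}$ is a nonzero multiple of $\partial_{t_{\overline{i+j}}}$; in particular $A_{1jk}(\boldsymbol0)=0$ if $\overline{1+j+k}\neq n$. *)

(* Defs.v *)
From HB Require Import structures.
From mathcomp Require Export all_boot all_order all_algebra.
From mathcomp Require Export reals complex mpoly.

Set Implicit Arguments.
Unset Strict Implicit.
Unset Printing Implicit Defensive.

Import Order.TTheory GRing.Theory Num.Theory.

Local Open Scope ring_scope.

(* Formal power series in t_0, ..., t_(m-1), given by the ordinary coefficient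
   of each monomial t^alpha. *)
Definition fps (K : Type) (m : nat) : Type := 'X_{1..m} -> K.

Section FormalPowerSeries.
Variables (K : comNzRingType) (m : nat).
Implicit Types (F G : fps K m) (i j k : 'I_m) (alpha : 'X_{1..m}).

Definition fps_mul F G : fps K m := fun alpha =>
  \sum_(b : 'X_{1..m < (mdeg alpha).+1, (mdeg alpha).+1}
         | alpha == (b.1 + b.2)%MM) F b.1 * G b.2.

Definition fps_var i : fps K m := fun alpha => (alpha == U_(i)%MM)%:R.

Definition fps_const (c : K) : fps K m := fun alpha =>
  if alpha == 0%MM then c else 0.

Definition fps_deriv i F : fps K m := fun alpha =>
  F (alpha + U_(i))%MM *+ (alpha i).+1.

Definition fps_deriv3 i j k F : fps K m :=
  fps_deriv i (fps_deriv j (fps_deriv k F)).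

(* The number A(alpha) in F = \sum_alpha A(alpha) t^alpha / alpha!. *)
Definition Acoef F alpha : K := F alpha *+ \prod_(i < m) (alpha i)`!.

(* The number A_ijk(alpha) = A(alpha + e_i + e_j + e_k). *)
Definition Acoef3 F i j k alpha : K :=
  Acoef F (alpha + U_(i) + U_(j) + U_(k))%MM.

End FormalPowerSeries.

Section Weights.
Variables (n : nat) (w : 'I_n.+1 -> nat).

Definition mu : nat := (\sum_(i < n.+1) w i)%N.

Lemma mu_gt1 : (1 <= n)%N -> (forall i, (0 < w i)%N) -> (1 < mu)%N.
Proof.
move=> n_gt0 w_gt0; have: (\sum_(i < n.+1) 1 <= mu)%N by apply: leq_sum.
by rewrite sum1_card card_ord; apply: leq_trans.
Qed.

Definition index1 (hn : (1 <= n)%N) (hw : forall i, (0 < w i)%N) : 'I_mu :=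
  Ordinal (mu_gt1 hn hw).

Lemma add_index_subproof (i j : 'I_mu) : ((i + j) %% mu < mu)%N.
Proof. by rewrite ltn_pmod // (leq_ltn_trans _ (ltn_ord i)). Qed.

(* The index i + j reduced modulo mu. *)
Definition add_index (i j : 'I_mu) : 'I_mu := Ordinal (add_index_subproof i j).

Definition spectrum : seq rat :=
  sort <=%R (flatten [seq [seq l%:R / (w i)%:R | l <- iota 0 (w i)]
                     | i <- enum 'I_n.+1]).

Definition s (k : nat) : rat := spectrum`_k.

Definition sigma (k : nat) : rat := k%:R - mu%:R * s k.

Definition I_ (gamma : rat) : {set 'I_n.+1} :=
  [set i | gamma * (w i)%:R \is a Num.int].

End Weights.

Section PotentialConditions.
Variables (R : realType) (n : nat) (w : 'I_n.+1 -> nat).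
Local Notation C := (R[i])%C.
Local Notation mu := (mu w).
Implicit Type F : fps C mu.

Definition gmx : 'M[C]_mu := \matrix_(k < mu, l < mu)
  if ((k + l) %% mu == n)%N then (\prod_(i in I_ w (s w k)) (w i)%:R)^-1
  else 0.

Definition gform (u v : 'rV[C]_mu) : C := (u *m gmx *m v^T) 0 0.

(* The vector d/dt_k in the tangent space at the base point t = 0. *)
Definition dt (k : 'I_mu) : 'rV[C]_mu := delta_mx 0 k.

Definition ginv : 'M[C]_mu := invmx gmx.

(* The index written a^star: the only b such that g^(ab) is nonzero. *)
Definition dual_index (a : 'I_mu) : 'I_mu :=
  odflt a [pick b | ginv a b != 0].

Definition wdvv F : Prop :=
  forall (i j k l : 'I_mu) (alpha : 'X_{1..mu}),
    \sum_(a < mu) ginv a (dual_index a) *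
      fps_mul (fps_deriv3 i j a F) (fps_deriv3 (dual_index a) k l F) alpha =
    \sum_(a < mu) ginv a (dual_index a) *
      fps_mul (fps_deriv3 j k a F) (fps_deriv3 (dual_index a) i l F) alpha.

(* The k-th component (1 - sigma(k)) t_k + delta_(k,1) mu of the Euler field. *)
Definition euler_comp (k : 'I_mu) : fps C mu := fun alpha =>
  ratr (1 - sigma w k) * fps_var C k alpha
  + @fps_const C mu (if (k == 1 :> nat)%N then mu%:R else 0) alpha.

Definition euler F : fps C mu := fun alpha =>
  \sum_(k < mu) fps_mul (euler_comp k) (fps_deriv k F) alpha.

(* Potentials are taken up to polynomials of degree <= 2, so only the
   coefficients of total degree >= 3 are compared. *)
Definition homogeneity F : Prop :=
  forall alpha : 'X_{1..mu}, (3 <= mdeg alpha)%N ->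
    euler F alpha = (3%:R - n%:R) * F alpha.

(* A product on the tangent space at t = 0 is given by its values
   [star i j] = d/dt_i * d/dt_j on the basis; each of these is a nonzero
   multiple of d/dt_k for k = i + j modulo mu.  For the product of a Frobenius
   structure, commutativity, associativity and compatibility with g follow
   from [initial_value] and [wdvv]. *)
Definition graded_product (star : 'I_mu -> 'I_mu -> 'rV[C]_mu) : Prop :=
  forall i j : 'I_mu, exists2 c : C, c != 0 & star i j = c *: dt (add_index i j).

Definition initial_value (star : 'I_mu -> 'I_mu -> 'rV[C]_mu) F : Prop :=
  forall i j k : 'I_mu, fps_deriv3 i j k F 0%MM = gform (star i j) (dt k).

(* The conditions satisfied by the potential of the canonical Frobenius
   structure of f = u_0 + ... + u_n on prod_i u_i^(w_i) = 1, with [star] its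
   product at the base point. *)
Definition is_potential (star : 'I_mu -> 'I_mu -> 'rV[C]_mu) F : Prop :=
  [/\ wdvv F, homogeneity F, graded_product star & initial_value star F].

End PotentialConditions.

(* Main.v *)
(** One shows by induction on [d] that the third derivatives F_ijk are
    determined below order [d].  The Euler field contains [mu] d/dt_1, so
    homogeneity expresses the coefficients of F_1jk of positive order through
    coefficients of F of lower order, while the numbers F_1jk(0) are given, or
    vanish.  At the base point d/dt_1 generates the tangent algebra, its powers
    running through multiples of all the d/dt_i; hence WDVV propagates the
    knowledge of the F_ijk from the index [i] to [1 + i] modulo [mu]. *)

Require Import Defs.

Set Implicit Arguments.
Unset Strict Implicit.
Unset Printing Implicit Defensive.

Import Order.TTheory GRing.Theory Num.Theory.

Local Open Scope ring_scope.

Lemma mdeg_gt0_addU (m : nat) (alpha : 'X_{1..m}) :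
  (0 < mdeg alpha)%N -> exists i beta, alpha = (beta + U_(i))%MM.
Proof.
rewrite lt0n mdeg_eq0 => alpha_neq0.
have [i alpha_i|alpha0] := pickP [pred i | alpha i != 0%N].
  by exists i, (alpha - U_(i))%MM; rewrite submK // lep1mP.
case/eqP: alpha_neq0; apply/mnmP => i; rewrite mnm0E.
by have /= /negbFE/eqP := alpha0 i.
Qed.

Lemma invmx_monomial (K : comUnitRingType) (m : nat) (f g : 'I_m -> 'I_m)
    (c : 'I_m -> K) :
    cancel g f -> (forall a, c a \is a GRing.unit) ->
  invmx (\matrix_(a, b) if b == f a then c a else 0) =
    \matrix_(a, b) if b == g a then (c b)^-1 else 0.
Proof.
move=> gK c_unit; set A := \matrix_(a, b) _; set B := (RHS).
suff BA : B *m A = 1%:M.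
  have [_ A_unit] := mulmx1_unit BA.
  by rewrite -[invmx A]mul1mx -BA -mulmxA mulmxV // mulmx1.
apply/matrixP => i j; rewrite !mxE (bigD1 (g i)) //= big1 => [|k /negPf ki].
  rewrite !mxE eqxx gK addr0 eq_sym.
  by case: eqP => _; rewrite ?mulr0 ?mulVr.
by rewrite !mxE ki mul0r.
Qed.

Section FormalPowerSeries.
Variables (K : comNzRingType) (m : nat).
Implicit Types (F G : fps K m) (i j k : 'I_m) (alpha beta gamma : 'X_{1..m}).
Implicit Types (c : K) (d : nat).

Lemma fps_mul_one_term F G beta gamma :
    (forall b b', (b + b' = beta + gamma)%MM -> b != beta -> F b * G b' = 0) ->
  fps_mul F G (beta + gamma)%MM = F beta * G gamma.
Proof.
move=> FG0; rewrite /fps_mul; set d := (mdeg _).+1.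
have lt_beta : (mdeg beta < d)%N by rewrite ltnS mdegD leq_addr.
have lt_gamma : (mdeg gamma < d)%N by rewrite ltnS mdegD leq_addl.
rewrite (bigD1 (BMultinom lt_beta, BMultinom lt_gamma)) //= big1 ?addr0 //.
case=> b1 b2 /= /andP[/eqP eq_b neq_b]; apply: FG0 => //.
apply: contraNneq neq_b => eq_b1; apply/eqP; congr pair; apply: val_inj => //=.
by move: eq_b; rewrite eq_b1 => /addmI.
Qed.

Lemma fps_mulZDl c F F' G alpha :
  fps_mul (fun b => c * F b + F' b) G alpha =
    c * fps_mul F G alpha + fps_mul F' G alpha.
Proof.
rewrite /fps_mul mulr_sumr -big_split; apply: eq_bigr => b _.
by rewrite mulrDl mulrA.
Qed.

Lemma fps_mulBr F G G' alpha :
  fps_mul F (fun b => G b - G' b) alpha =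
    fps_mul F G alpha - fps_mul F G' alpha.
Proof. by rewrite /fps_mul -sumrB; apply: eq_bigr => b _; rewrite mulrBr. Qed.

Lemma fps_mul_const c G alpha : fps_mul (fps_const c) G alpha = c * G alpha.
Proof.
rewrite -{1}[alpha]add0m fps_mul_one_term /fps_const ?eqxx // => b b' _.
by move/negPf ->; rewrite mul0r.
Qed.

Lemma fps_mul_var_deriv i F alpha :
  fps_mul (fps_var K i) (fps_deriv i F) alpha = F alpha *+ alpha i.
Proof.
have [alpha_i|alpha_i] := eqVneq (alpha i) 0%N.
  rewrite alpha_i mulr0n /fps_mul big1 // => -[b1 b2] /= /eqP eq_b.
  rewrite /fps_var; case: eqP => [b1E|]; last by rewrite mul0r.
  by have /mnmP/(_ i) := eq_b; rewrite b1E mnmDE mnm1E eqxx alpha_i.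
have le_alpha : (U_(i) <= alpha)%MM by rewrite lep1mP.
rewrite -{1}(submK le_alpha) addmC fps_mul_one_term /fps_var.
  rewrite eqxx mul1r /fps_deriv submK // mnmBE mnm1E eqxx subn1 prednK //.
  by rewrite lt0n.
by move=> b b' _ /negPf ->; rewrite mul0r.
Qed.

Lemma fps_derivC i j F :
  fps_deriv i (fps_deriv j F) =1 fps_deriv j (fps_deriv i F).
Proof.
move=> alpha; have [->//|neq_ij] := eqVneq i j.
rewrite /fps_deriv !mnmDE !mnm1E (eq_sym j) (negPf neq_ij) !addn0 mulrnAC.
by rewrite -addmA (addmC U_(i)%MM) addmA.
Qed.

Lemma fps_deriv3CA i j k F : fps_deriv3 i j k F =1 fps_deriv3 j i k F.
Proof. exact: fps_derivC. Qed.

Definition fps_eqmod d F G : Prop :=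
  forall alpha, (mdeg alpha < d)%N -> F alpha = G alpha.

Definition deriv3_eqmod d F G : Prop :=
  forall i j k, fps_eqmod d (fps_deriv3 i j k F) (fps_deriv3 i j k G).

Lemma fps_eqmodW d d' F G : (d <= d')%N -> fps_eqmod d' F G -> fps_eqmod d F G.
Proof. by move=> le_d eqFG alpha /leq_trans lt_d; apply/eqFG/lt_d. Qed.

Lemma fps_mul_eqmod d F F' G G' :
    fps_eqmod d F F' -> fps_eqmod d G G' ->
  fps_eqmod d (fps_mul F G) (fps_mul F' G').
Proof.
move=> eqF eqG alpha lt_d; apply: eq_bigr => -[b1 b2] /= _.
by rewrite eqF ?eqG // (leq_trans (bmdeg _)).
Qed.

Lemma fps_mulB_eqmod F F' G G' alpha :
    fps_eqmod (mdeg alpha).+1 F F' -> fps_eqmod (mdeg alpha) G G' ->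
  fps_mul F G alpha - fps_mul F' G' alpha = F 0%MM * (G alpha - G' alpha).
Proof.
move=> eqF eqG; rewrite -(@fps_mul_eqmod (mdeg alpha).+1 F F' G' G') //.
rewrite -fps_mulBr -{1}[alpha]add0m.
rewrite fps_mul_one_term // => b c; rewrite add0m => eq_bc b_neq0.
rewrite eqG ?subrr ?mulr0 //.
by rewrite -eq_bc mdegD -[ltnLHS]add0n ltn_add2r lt0n mdeg_eq0.
Qed.

Definition wdvv_with (eta : 'I_m -> K) (dual : 'I_m -> 'I_m) F : Prop :=
  forall i j k l alpha,
    \sum_a eta a *
      fps_mul (fps_deriv3 i j a F) (fps_deriv3 (dual a) k l F) alpha =
    \sum_a eta a *
      fps_mul (fps_deriv3 j k a F) (fps_deriv3 (dual a) i l F) alpha.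

End FormalPowerSeries.

Section WDVVStep.
Variables (K : idomainType) (m : nat).
Variables (eta : 'I_m -> K) (dual : 'I_m -> 'I_m) (F F' : fps K m).
Hypotheses (F_wdvv : wdvv_with eta dual F) (F'_wdvv : wdvv_with eta dual F').

(* In the WDVV equation with indices (e, i, j, l), all terms of order [d] are
   known to agree, except the products F_eib(0) F_(dual b)jl; among these only
   the one with b = a is nonzero. *)
Lemma wdvv_deriv3_eqmodS d e i a :
    eta a != 0 -> (forall b, (fps_deriv3 e i b F 0%MM == 0) = (b != a)) ->
    deriv3_eqmod d F F' ->
    (forall j k, fps_eqmod d.+1 (fps_deriv3 e j k F) (fps_deriv3 e j k F')) ->
    (forall j k, fps_eqmod d.+1 (fps_deriv3 i j k F) (fps_deriv3 i j k F')) ->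
  forall j l,
    fps_eqmod d.+1 (fps_deriv3 (dual a) j l F) (fps_deriv3 (dual a) j l F').
Proof.
move=> eta_neq0 Fei0 eqd eqe eqi j l gamma le_d.
have top_eq0 : \sum_b eta b * (fps_deriv3 e i b F 0%MM *
    (fps_deriv3 (dual b) j l F gamma - fps_deriv3 (dual b) j l F' gamma)) = 0.
  have eqe_gamma b := fps_eqmodW le_d (eqe i b).
  have eqd_gamma b :=
    fps_eqmodW (le_d : (mdeg gamma <= d)%N) (eqd (dual b) j l).
  under eq_bigr => b _ do
    rewrite -(fps_mulB_eqmod (eqe_gamma b) (eqd_gamma b)) mulrBr.
  rewrite sumrB F_wdvv F'_wdvv; apply/eqP; rewrite subr_eq0; apply/eqP.
  apply: eq_bigr => b _; congr (_ * _).
  apply: (fps_mul_eqmod _ _ le_d) => // beta lt_beta.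
  by rewrite !(fps_deriv3CA (dual b)) eqe.
move: top_eq0; rewrite (bigD1 a) //= big1 ?addr0 => [/eqP|b neq_ba].
  by rewrite !mulf_eq0 (negPf eta_neq0) Fei0 eqxx subr_eq0 => /eqP.
have /eqP -> : fps_deriv3 e i b F 0%MM == 0 by rewrite Fei0.
by rewrite mul0r mulr0.
Qed.

End WDVVStep.

Section CharacteristicZero.
Variables (K : numDomainType) (m : nat).
Implicit Types (F : fps K m) (alpha : 'X_{1..m}).

Lemma fps_deriv3_eq F F' i j k alpha :
  fps_deriv3 i j k F alpha = fps_deriv3 i j k F' alpha <->
  F (alpha + U_(i) + U_(j) + U_(k))%MM = F' (alpha + U_(i) + U_(j) + U_(k))%MM.
Proof.
rewrite /fps_deriv3 /fps_deriv; split=> [|-> //].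
by do 3!move/(pmulrnI (ltn0Sn _)).
Qed.

Lemma Acoef_eq F F' alpha :
  Acoef F alpha = Acoef F' alpha <-> F alpha = F' alpha.
Proof.
rewrite /Acoef; split=> [/pmulrnI|-> //]; apply.
by apply: prodn_gt0 => i; apply: fact_gt0.
Qed.

Lemma deriv3_eqmodP d F F' :
  deriv3_eqmod d F F' <->
  (forall alpha, (3 <= mdeg alpha < d.+3)%N -> F alpha = F' alpha).
Proof.
split=> [eqd alpha|eqF i j k alpha lt_d]; last first.
  by apply/fps_deriv3_eq/eqF; rewrite !mdegD !mdeg1 !addn1.
case/andP=> ge3 lt_d; move: ge3 lt_d.
case: (posnP (mdeg alpha)) => [->//|/mdeg_gt0_addU[k [beta ->]]].
rewrite mdegD mdeg1 addn1 !ltnS => ge2; move: (ge2).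
have /mdeg_gt0_addU[j [gamma ->]] := ltnW ge2.
rewrite mdegD mdeg1 addn1 !ltnS => /mdeg_gt0_addU[i [delta ->]].
by rewrite mdegD mdeg1 addn1 => lt_d; apply/fps_deriv3_eq/eqd.
Qed.

End CharacteristicZero.

Section FlatPairing.
Variables (R : realType) (n : nat) (w : 'I_n.+1 -> nat).
Hypothesis w_gt0 : forall i, (0 < w i)%N.
Local Notation C := (complex R).
Local Notation mu := (mu w).

Lemma ltn_mu : (n < mu)%N.
Proof.
have: (\sum_(i < n.+1) 1 <= mu)%N by apply: leq_sum.
by rewrite sum1_card card_ord.
Qed.

Definition dual_ord (a : 'I_mu) : 'I_mu :=
  Ordinal (ltn_pmod (n + (mu - a)) (leq_ltn_trans (leq0n n) ltn_mu)).

Lemma modn_add_eq_dual (a b : 'I_mu) :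
  ((a + b) %% mu == n)%N = (b == dual_ord a).
Proof.
rewrite -[X in _ == X](modn_small ltn_mu).
rewrite -(eqn_modDr (mu - a)) addnAC subnKC ?(ltnW (ltn_ord a)) //.
by rewrite modnDl (modn_small (ltn_ord b)).
Qed.

Lemma dual_ordK : involutive dual_ord.
Proof.
by move=> a; apply/esym/eqP; rewrite -modn_add_eq_dual addnC modn_add_eq_dual.
Qed.

Definition weight_prod (k : 'I_mu) : C := \prod_(i in I_ w (s w k)) (w i)%:R.

Lemma weight_prod_neq0 k : weight_prod k != 0.
Proof. by apply/prodf_neq0 => i _; rewrite pnatr_eq0 -lt0n. Qed.

Lemma gmxE :
  gmx R w = \matrix_(a, b) if b == dual_ord a then (weight_prod a)^-1 else 0.
Proof. by apply/matrixP => a b; rewrite !mxE modn_add_eq_dual. Qed.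

Lemma ginvE a b : ginv R w a b = if b == dual_ord a then weight_prod b else 0.
Proof.
rewrite /ginv gmxE (invmx_monomial dual_ordK) ?mxE ?invrK // => k.
by rewrite unitrV unitfE weight_prod_neq0.
Qed.

Lemma dual_indexE a : dual_index R a = dual_ord a.
Proof.
rewrite /dual_index; case: pickP => [b|/(_ (dual_ord a))] /=; rewrite ginvE.
  by case: (b =P dual_ord a) => //; rewrite eqxx.
by rewrite eqxx weight_prod_neq0.
Qed.

Lemma ginv_dual_neq0 a : ginv R w a (dual_index R a) != 0.
Proof. by rewrite dual_indexE ginvE eqxx weight_prod_neq0. Qed.

Lemma gform_dt i j : gform (dt R i) (dt R j) = gmx R w i j.
Proof. by rewrite /gform /dt trmx_delta -rowE -colE !mxE. Qed.

Lemma initial_value_eq0 star (F : fps C mu) i j k :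
    graded_product star -> initial_value star F ->
  (fps_deriv3 i j k F 0%MM == 0) = (k != dual_ord (add_index i j)).
Proof.
move=> star_graded ->; have [c /negPf c_neq0 ->] := star_graded i j.
rewrite /gform -!scalemxAl mxE -/(gform _ _) gform_dt gmxE mxE mulf_eq0 c_neq0.
by case: ifP => _ /=; rewrite ?eqxx // invr_eq0 (negPf (weight_prod_neq0 _)).
Qed.

End FlatPairing.

Section Reconstruction.
Variables (R : realType) (n : nat) (w : 'I_n.+1 -> nat).
Hypotheses (hn : (1 <= n)%N) (hw : forall i, (0 < w i)%N).
Local Notation C := (complex R).
Local Notation mu := (mu w).
Local Notation e1 := (index1 hn hw).

Lemma add_index1_ind (P : 'I_mu -> Prop) :
  P e1 -> (forall i, P i -> P (add_index e1 i)) -> forall i, P i.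
Proof.
move=> P1 PS i; have mu_gt0 : (0 < mu)%N := ltnW (mu_gt1 hn hw).
have PmodS k : P (Ordinal (ltn_pmod k.+1 mu_gt0)).
  elim: k => [|k IHk].
    suff -> : Ordinal (ltn_pmod 1 mu_gt0) = e1 by [].
    by apply: val_inj; rewrite /= modn_small // mu_gt1.
  suff -> : Ordinal (ltn_pmod k.+2 mu_gt0) =
            add_index e1 (Ordinal (ltn_pmod k.+1 mu_gt0)) by apply: PS.
  by apply: val_inj; rewrite /= modnDmr.
suff -> : i = Ordinal (ltn_pmod (i + mu.-1).+1 mu_gt0) by [].
by apply: val_inj; rewrite /= -addnS prednK // modnDr modn_small.
Qed.

Lemma eulerE (F : fps C mu) alpha :
  euler F alpha =
    \sum_(k < mu) ratr (1 - sigma w k) * (F alpha *+ alpha k)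
    + mu%:R * fps_deriv e1 F alpha.
Proof.
rewrite /euler /euler_comp.
under eq_bigr => k _ do rewrite fps_mulZDl fps_mul_var_deriv fps_mul_const.
rewrite big_split /=; congr (_ + _).
rewrite (bigD1 e1) //= big1 ?addr0 // => k /negPf k_neq1.
by rewrite -[(k == 1 :> nat)%N]/(k == e1) k_neq1 mul0r.
Qed.

Variables F F' : fps C mu.

Lemma homogeneity_addU_index1 alpha :
    homogeneity F -> homogeneity F' -> (3 <= mdeg alpha)%N ->
    F alpha = F' alpha ->
  F (alpha + U_(e1))%MM = F' (alpha + U_(e1))%MM.
Proof.
move=> F_homog F'_homog ge3 eqF.
have := F_homog _ ge3; rewrite eqF -(F'_homog _ ge3) !eulerE eqF.
have mu_neq0 : mu%:R != 0 :> C by rewrite pnatr_eq0 -lt0n (ltnW (mu_gt1 hn hw)).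
by move=> /addrI /(mulfI mu_neq0) /(pmulrnI (ltn0Sn _)).
Qed.

Lemma homogeneity_deriv3_eqmodS d j k :
    homogeneity F -> homogeneity F' -> deriv3_eqmod d F F' ->
    fps_deriv3 e1 j k F 0%MM = fps_deriv3 e1 j k F' 0%MM ->
  fps_eqmod d.+1 (fps_deriv3 e1 j k F) (fps_deriv3 e1 j k F').
Proof.
move=> F_homog F'_homog /deriv3_eqmodP eqd eq0 gamma le_d.
have [->//|gamma_neq0] := eqVneq gamma 0%MM.
apply/fps_deriv3_eq; rewrite -2!addmA (addmC U_(e1)%MM) addmA.
have ge3 : (3 <= mdeg (gamma + (U_(j) + U_(k)))%MM)%N.
  by rewrite !mdegD !mdeg1 addn2 !ltnS lt0n mdeg_eq0.
apply: homogeneity_addU_index1 => //; apply: eqd.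
by rewrite ge3 !mdegD !mdeg1 addn2.
Qed.

Variables star star' : 'I_mu -> 'I_mu -> 'rV[C]_mu.
Hypotheses (hF : is_potential star F) (hF' : is_potential star' F').
Hypothesis hA : forall j k : 'I_mu, ((1 + j + k) %% mu)%N = n ->
  Acoef3 F e1 j k 0%MM = Acoef3 F' e1 j k 0%MM.

Lemma potential_deriv3_index1_at0 j k :
  fps_deriv3 e1 j k F 0%MM = fps_deriv3 e1 j k F' 0%MM.
Proof.
case: hF hF' => [_ _ star_graded F_init] [_ _ star'_graded F'_init].
have [k_dual|k_ndual] := eqVneq k (dual_ord hw (add_index e1 j)).
  apply/fps_deriv3_eq/Acoef_eq/hA/eqP.
  rewrite -modnDml -[((1 + j) %% mu)%N]/(add_index e1 j : nat).
  by rewrite (modn_add_eq_dual hw) k_dual.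
transitivity (0 : C); last apply/esym.
  by apply/eqP; rewrite (initial_value_eq0 hw _ _ _ star_graded F_init).
by apply/eqP; rewrite (initial_value_eq0 hw _ _ _ star'_graded F'_init).
Qed.

Lemma potential_deriv3_eqmodS d :
  deriv3_eqmod d F F' -> deriv3_eqmod d.+1 F F'.
Proof.
case: (hF) (hF') => [F_wdvv F_homog star_graded F_init] [F'_wdvv F'_homog _ _].
move=> eqd.
have eq1 j k : fps_eqmod d.+1 (fps_deriv3 e1 j k F) (fps_deriv3 e1 j k F').
  exact: homogeneity_deriv3_eqmodS (potential_deriv3_index1_at0 j k).
elim/add_index1_ind => // i eqi.
rewrite -[add_index e1 i](dual_ordK hw) -(dual_indexE R).
apply: (wdvv_deriv3_eqmodS F_wdvv F'_wdvv) eqd eq1 eqi.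
  exact: ginv_dual_neq0.
by move=> b; apply: initial_value_eq0 F_init.
Qed.

Lemma potential_deriv3_eqmod d : deriv3_eqmod d F F'.
Proof. by elim: d => [//|d]; apply: potential_deriv3_eqmodS. Qed.

End Reconstruction.

Theorem mainTheorem6 (R : realType) (n : nat) (hn : (1 <= n)%N)
    (w : 'I_n.+1 -> nat) (hw : forall i : 'I_n.+1, (0 < w i)%N)
    (star star' : 'I_(mu w) -> 'I_(mu w) -> 'rV[complex R]_(mu w))
    (F F' : fps (complex R) (mu w))
    (hF : is_potential star F) (hF' : is_potential star' F')
    (hA : forall j k : 'I_(mu w), ((1 + j + k) %% mu w)%N = n ->
       Acoef3 F (index1 hn hw) j k 0%MM = Acoef3 F' (index1 hn hw) j k 0%MM) :
  forall alpha : 'X_{1..mu w}, (3 <= mdeg alpha)%N ->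
    Acoef F alpha = Acoef F' alpha.
Proof.
move=> alpha ge3; apply/Acoef_eq.
have /deriv3_eqmodP := potential_deriv3_eqmod hF hF' hA (d := mdeg alpha).
by apply; rewrite ge3 /= ltnS leqW.
Qed.
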